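(* Let $1<p<\infty$, let $q=p/(p-1)$, and let $(X,d,\mu)$ be a metric measure space satisfying the generalized weak $q$-Boman covering property with constant $C>0$. Then the centered maximal operator $M=M_\mu$ is of weak type $(p,p)$, with $\|M\|_{L^p\to L^{p,\infty}}\le C$.
   Context: A Borel measure $\mu$ on a metric space $(X,d)$ is $\tau$-additive if for every collection $\{U_\alpha\}_{\alpha\in\Lambda}$ of open sets, $\mu(\cup_\alpha U_\alpha)=\sup \mu(\cup_{i=1}^n U_{\alpha_i})$, the supremum being over all finite subcollections. A metric measure space $(X,d,\mu)$ is a metric space with a $\tau$-additive Borel measure $\mu$, not identically zero, that is finite on bounded Borel sets. $B(x,r)=\{y: d(x,y)<r\}$ and $B^{cl}(x,r)=\{y: d(x,y)\le r\}$; radii are always $>0$. The support of $\mu$ is the complement of $\cup\{B(x,r): x\in X,\ r>0,\ \mu B(x,r)=0\}$. For $1\le s\le\infty$, $(X,d,\mu)$ has the generalized weak $s$-Boman covering property with constant $C>0$ if for every $r>0$ there exists $T=T(r)\in(0,1)$ such that for all finite sequences of closed balls $\{B^{cl}(x_n,r_n)\}_{1\le n\le N}$ with $x_n$ in the support of $\mu$, of weights $\{w_n\}_{1\le n\le N}$ with $w_n>0$, of contractions $\{t_n\}_{1\le n\le N}$ with $0<t_n\le T(r_n)$, and of measurable sets $\{E_n\}_{1\le n\le N}$ with $\mu E_n>0$ and $E_n\subset B^{cl}(x_n,t_nr_n)$, we have $$\left\| \sum_{1 \le n \le N}\frac{w_n \mathbf{1}_{B^{cl}(x_{n}, r_{n})}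 }{\mu B^{cl}(x_{n}, r_{n})} \right\|_{L^s(\mu)} \le C \left\| \sum_{1 \le n \le N}\frac{w_n \mathbf{1}_{E_n} }{\mu E_n} \right\|_{L^s(\mu)}.$$ The centered maximal operator is, for $g$ locally integrable, $$M_{\mu} g(x) := \sup _{\{r >0 : \ 0 < \mu (B^{cl}(x, r))\}} \frac{1}{\mu (B^{cl}(x, r))} \int _{B^{cl}(x, r)} |g|\, d\mu.$$ A sublinear operator $T$ is of weak type $(p,p)$ if there is $c>0$ such that $\mu(\{Tg>\alpha\})\le (c\|g\|_{L^p(\mu)}/\alpha)^p$ for all $g\in L^p(\mu)$ and $\alpha>0$; the lowest such $c$ is $\|T\|_{L^p\to L^{p,\infty}}$. *)

(* Defs.v *)
From HB Require Import structures.
From mathcomp Require Import all_boot all_order all_algebra.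
From mathcomp Require Import all_classical all_reals all_analysis.

Set Implicit Arguments.
Unset Strict Implicit.
Unset Printing Implicit Defensive.
Import Order.TTheory GRing.Theory Num.Theory.
Import numFieldNormedType.Exports.

Local Open Scope classical_set_scope.
Local Open Scope ring_scope.

(* The two structures are tied together (measurable sets = Borel sets) by
   [metric_measure_space] below. *)
#[short(type="measurableMetricType")]
HB.structure Definition MeasurableMetric (R : realType) (d : measure_display) :=
  {T of Metric R T & Measurable d T}.

Section metric_measure.
Context (R : realType) (d : measure_display) (X : measurableMetricType R d).
Variable mu : {measure set X -> \bar R}.

(* The library's [closed_ball x r] is the closure of [ball x r], which can be
   strictly smaller in a general metric space. *)
Definition cball (x : X) (r : R) : set X := [set y | mdist x y <= r].

Definition metric_bounded (A : set X) : Prop :=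
  exists x r, A `<=` ball x r.

Local Open Scope ereal_scope.

Definition tau_additive : Prop :=
  forall (I : Type) (U : I -> set X), (forall i, open (U i)) ->
    mu (\bigcup_i U i) =
    ereal_sup [set mu (\bigcup_(i in D) U i) | D in @finite_set I].

Record metric_measure_space : Prop := {
  mms_borel : @measurable d X = <<s @open X >> ;
  mms_tau_additive : tau_additive ;
  mms_neq0 : exists A : set X, measurable A /\ mu A != 0 ;
  mms_finite_bounded : forall A : set X,
    measurable A -> metric_bounded A -> mu A < +oo }.

Definition measure_support : set X :=
  ~` \bigcup_(b in [set b : X * R | (0 < b.2)%R /\ mu (ball b.1 b.2) = 0])
       ball b.1 b.2.

(* In a metric measure space every denominator below is positive and finite:
   the [x n] lie in the support and all the sets involved are bounded. *)
Definition weak_boman (s : \bar R) (C : R) : Prop :=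
  (0 < C)%R /\
  exists T : R -> R, (forall r, 0 < r -> 0 < T r < 1)%R /\
  forall (N : nat) (x : 'I_N -> X) (r w t : 'I_N -> R) (E : 'I_N -> set X),
    (forall n, measure_support (x n)) ->
    (forall n, 0 < r n)%R ->
    (forall n, 0 < w n)%R ->
    (forall n, 0 < t n <= T (r n))%R ->
    (forall n, measurable (E n)) ->
    (forall n, 0 < mu (E n)) ->
    (forall n, E n `<=` cball (x n) (t n * r n)%R) ->
    'N[mu]_s [(fun y => \sum_(n < N)
        (w n * \1_(cball (x n) (r n)) y)%:E / mu (cball (x n) (r n)))]
    <= C%:E *
    'N[mu]_s [(fun y => \sum_(n < N) (w n * \1_(E n) y)%:E / mu (E n))].

Definition centered_maximal (g : X -> R) (x : X) : \bar R :=
  ereal_sup [set (mu (cball x r))^-1 * \int[mu]_(y in cball x r) `|(g y)%:E|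
            | r in [set r | (0 < r)%R /\ 0 < mu (cball x r)]].

(* The value of [mu] is meaningful only on measurable sets, so measurability
   of the superlevel sets is required explicitly. *)
Definition weak_type_bound (p : R) (T : (X -> R) -> X -> \bar R) (c : R)
    : Prop :=
  forall g : X -> R, g \in Lfun mu p%:E -> forall a : R, (0 < a)%R ->
    measurable [set x | a%:E < T g x] /\
    mu [set x | a%:E < T g x] <=
      (c%:E * 'N[mu]_p%:E [EFin \o g] / a%:E) `^ p.

Definition weak_type (p : R) (T : (X -> R) -> X -> \bar R) : Prop :=
  exists c : R, (0 < c)%R /\ weak_type_bound p T c.

Definition weak_type_norm (p : R) (T : (X -> R) -> X -> \bar R) : \bar R :=
  ereal_inf [set c%:E | c in [set c | (0 < c)%R /\ weak_type_bound p T c]].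

End metric_measure.

(* Main.v *)
Require Import Defs.
From mathcomp Require Import all_boot all_order all_algebra.
From mathcomp Require Import all_classical all_reals all_analysis.
From mathcomp Require Import measurable_realfun.

(** Write [A] for the superlevel set where the maximal function of [g] exceeds
    [a], and [S] for the support of [mu].

    Each point [x] of [A] carries a closed ball [B_x] of some radius [r_x] on
    which the average of [|g|] exceeds [a]. If [x] also lies in [S], the Boman
    hypothesis can be applied to [B_x], with a contraction factor [T(r_x)]
    that depends on the radius only. The open balls of center [x] and radius
    [T(r_x) r_x], for [x] in [A] and [S], cover [A] up to the complement of the
    support, which is null by tau-additivity ([setC_support_null]). Again by
    tau-additivity ([tau_additive_bigcup_le]) it is enough to bound the measure
    of every finite union [U] of these small balls.

    Cut [U] into disjoint measurable pieces [E_n], the [n]-th one inside the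
    [n]-th small ball, and give the big ball [B_n] the weight
    [w_n = mu E_n]. Averaging [|g|] over the [B_n] with these weights and using
    Hoelder's inequality gives
      [a mu(U) = sum_n a w_n <= int |g| sum_n w_n 1_{B_n} / mu(B_n)
               <= |g|_p | sum_n w_n 1_{B_n} / mu(B_n) |_q]
    ([weak_boman_duality]). For this choice of weights the right-hand side of
    the Boman inequality is the [L^q] norm of the indicator of [U], so the last
    factor is at most [C mu(U)^(1/q)] ([weak_boman_trivIset]). Since [mu(U)] is
    finite, one power of it can be absorbed ([powR_absorb]), which leaves
    [mu(U) <= (C |g|_p / a)^p]: the weak type inequality with constant [C]
    itself.

    Measurability of [A] comes from the fact that it is open
    ([open_centered_maximal_gt]): as [mu] is finite on balls,
    [r |-> mu(B(x,r))] is right-continuous for closed balls, so a ball around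
    [x] on which the average is too large can be enlarged slightly and then
    recentered at any point near [x]. *)

Set Implicit Arguments.
Unset Strict Implicit.
Unset Printing Implicit Defensive.
Import Order.TTheory GRing.Theory Num.Theory.
Import numFieldNormedType.Exports.
Local Open Scope classical_set_scope.
Local Open Scope ring_scope.

(** * Indicator functions in integrals and norms *)

Lemma subset_integral_abs (d : measure_display) (T : measurableType d)
    (R : realType) (mu : {measure set T -> \bar R}) (g : T -> R) (A B : set T) :
  measurable_fun setT g -> measurable A -> measurable B -> A `<=` B ->
  (\int[mu]_(y in A) `|(g y)%:E| <= \int[mu]_(y in B) `|(g y)%:E|)%E.
Proof.
move=> mg mA mB AB; apply: ge0_subset_integral => //.
apply: measurable_funTS; apply: measurableT_comp => //.
exact/measurable_EFinP.
Qed.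

Lemma sum_indic_trivIset (R : realType) (T : Type) (E : nat -> set T)
    (s : seq nat) (y : T) :
  uniq s -> trivIset setT E ->
  \sum_(i <- s) \1_(E i) y = \1_(\bigcup_(i in [set` s]) E i) y :> R.
Proof.
move=> us tE.
have [[k /= sk Eky]|nE] := pselect ((\bigcup_(i in [set` s]) E i) y).
  rewrite (bigD1_seq k)//= big1 => [|i ik].
    by rewrite addr0 !indicE !mem_set//; exists k.
  rewrite indicE memNset// => Eiy; move/eqP: ik; apply.
  by apply: (tE i k) => //; exists y.
rewrite indicE memNset// big_seq big1// => i si.
by rewrite indicE memNset// => Eiy; apply: nE; exists i.
Qed.

Lemma Lnorm_indic (d : measure_display) (T : measurableType d) (R : realType)
    (mu : {measure set T -> \bar R}) (q : R) (U : set T) :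
  0 < q -> measurable U ->
  ('N[mu]_q%:E[EFin \o \1_U] = mu U `^ q^-1)%E.
Proof.
move=> q0 mU; rewrite unlock; congr poweR.
rewrite -[in RHS](setIT U) -integral_indic//; apply: eq_integral => y _ /=.
rewrite indicE; case: (y \in U).
  by rewrite normr1 powR1.
by rewrite normr0 powR0// gt_eqF.
Qed.

Lemma integral_abs_indic (d : measure_display) (T : measurableType d)
    (R : realType) (mu : {measure set T -> \bar R}) (g : T -> R) (c : R)
    (B : set T) :
  measurable_fun setT g -> 0 <= c -> measurable B ->
  (c%:E * \int[mu]_(y in B) `|(g y)%:E| =
   \int[mu]_y (`|g y| * (c * \1_B y))%:E)%E.
Proof.
move=> mg c0 mB.
have mabs : measurable_fun setT (fun y => `|(g y)%:E|)%E.
  by apply: measurableT_comp => //; exact/measurable_EFinP.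
rewrite integral_mkcond -ge0_integralZl//.
- apply: eq_integral => y _; rewrite epatch_indic /= -!EFinM.
  by rewrite mulrCA mulrA.
- by apply/(measurable_restrictT _ _).1 => //; exact: measurable_funTS.
- by move=> y _; rewrite erestrict_ge0.
Qed.

(** Since [1 - 1/q = 1/p], dividing by [m^(1/q)] leaves [m^(1/p)] on the left;
    [m] being a real number is what allows the division. *)
Lemma powR_absorb (R : realType) (a m K p q : R) :
  0 < a -> 0 <= m -> 0 <= K -> 0 < p -> p^-1 + q^-1 = 1 ->
  a * m <= K * m `^ q^-1 -> m <= (K / a) `^ p.
Proof.
move=> a0 m0 K0 p0 pq; have [->|mN0] := eqVneq m 0; first by rewrite powR_ge0.
have {mN0} {}m0 : 0 < m by rewrite lt0r mN0.
rewrite -{1}(powRr1 (ltW m0)) -pq powRD ?(gt_eqF m0)//=; last by rewrite implybT.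
rewrite mulrA ler_pM2r ?powR_gt0// -ler_pdivlMl// mulrC => h.
rewrite -[leLHS](powRr1 (ltW m0)) -(mulVf (lt0r_neq0 p0)) powRrM.
apply: ge0_ler_powR; rewrite ?nnegrE ?powR_ge0 ?divr_ge0//; exact: ltW.
Qed.

(** * Balls in a metric space *)

Section closed_balls.
Context (R : realType) (d : measure_display) (X : measurableMetricType R d).
Implicit Types (x y : X) (r s : R).

Lemma open_mball x r : open (ball x r).
Proof.
rewrite openE => y; rewrite ballEmdist /= => xy.
apply/nbhs_ballP; exists (r - mdist x y) => /=; first by rewrite subr_gt0.
move=> z; rewrite !ballEmdist /= ltrBrDl; apply: le_lt_trans.
exact: metric_triangle.
Qed.

Lemma ball_sub_cball x r : ball x r `<=` cball x r.
Proof. by move=> y; rewrite ballEmdist /cball /= => /ltW. Qed.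

Lemma cball_sub_cball x y r s : mdist y x + r <= s -> cball x r `<=` cball y s.
Proof.
move=> rs z; rewrite /cball /= => xz; apply: le_trans rs.
by apply: le_trans (metric_triangle _ x _) _; rewrite lerD2l.
Qed.

Lemma le_cball x r s : r <= s -> cball x r `<=` cball x s.
Proof. by move=> rs; apply: cball_sub_cball; rewrite mdistxx add0r. Qed.

Lemma closed_cball x r : closed (cball x r).
Proof.
rewrite -openC openE => y; rewrite /cball /= => /negP; rewrite -ltNge => ry.
apply/nbhs_ballP; exists (mdist x y - r) => /=; first by rewrite subr_gt0.
move=> z; rewrite ballEmdist /= metric_sym => zy xz; move: zy.
rewrite ltNge lerBlDl => /negP; apply.
by apply: le_trans (metric_triangle _ z _) _; rewrite lerD2r.
Qed.

Lemma bigcap_cball x r : \bigcap_n cball x (r + n.+1%:R^-1) = cball x r.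
Proof.
apply/seteqP; split => [y xy|y xy n _]; last first.
  by apply: le_cball xy; rewrite lerDl.
rewrite /cball /= leNgt; apply/negP => rxy.
have /ltr_add_invr[n] := rxy; rewrite ltNge => /negP; apply.
exact: (xy n I).
Qed.

End closed_balls.

(** * Closed balls in a metric measure space *)

Section metric_measure.
Context (R : realType) (d : measure_display) (X : measurableMetricType R d).
Variable mu : {measure set X -> \bar R}.
Hypothesis hmu : metric_measure_space mu.
Local Open Scope ereal_scope.
Implicit Types (x y : X) (r s : R).

Lemma measurable_open (U : set X) : open U -> measurable U.
Proof. by rewrite (mms_borel hmu) => oU; exact: sub_sigma_algebra. Qed.

Lemma measurable_cball x r : measurable (cball x r).
Proof.
rewrite -[cball x r]setCK; apply: measurableC; apply: measurable_open.
by rewrite openC; exact: closed_cball.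
Qed.

Lemma cball_ltoo x r : mu (cball x r) < +oo.
Proof.
apply: (mms_finite_bounded hmu); first exact: measurable_cball.
exists x, (r + 1)%R => y; rewrite /cball ballEmdist /=.
by move=> /le_lt_trans; apply; rewrite ltrDl.
Qed.

Lemma cball_fin_num x r : mu (cball x r) \is a fin_num.
Proof. by rewrite ge0_fin_numE// cball_ltoo. Qed.

Lemma cball_gt0 x r : (0 < r)%R -> measure_support mu x -> 0 < mu (cball x r).
Proof.
move=> r0 sx; rewrite lt0e measure_ge0 andbT; apply/eqP => B0; apply: sx.
exists (x, r) => /=; last by rewrite ballEmdist /= mdistxx.
split => //; apply: (subset_measure0 _ (measurable_cball x r)) B0.
  exact/measurable_open/open_mball.
exact: ball_sub_cball.
Qed.

(** Closed balls decrease to [cball x r] as the radius decreases to [r], and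
    they have finite measure, so [mu] is continuous along them. *)
Lemma measure_cball_right_continuous x r (c : \bar R) :
  mu (cball x r) < c -> exists2 e, (0 < e)%R & mu (cball x (r + e)) < c.
Proof.
move=> rc; pose F n := cball x (r + n.+1%:R^-1).
have : mu \o F @ \oo --> mu (cball x r).
  rewrite -bigcap_cball; apply: nonincreasing_cvg_mu => //.
  - exact: cball_ltoo.
  - by move=> n; exact: measurable_cball.
  - by rewrite bigcap_cball; exact: measurable_cball.
  - move=> m n mn; apply/subsetPset/le_cball.
    by rewrite lerD2l lef_pV2 ?posrE// ler_nat.
move=> /(_ [set y | y < c]) [].
  by apply: open_nbhs_nbhs; split => //; exact: open_ereal_lt_ereal.
move=> n _ /(_ n (leqnn n)) /= Fn.
by exists n.+1%:R^-1%R.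
Qed.

(** * Null sets and unions under tau-additivity *)

(** The form in which tau-additivity is used: a bound on all finite
    subunions of a family of open sets passes to the whole union, even an
    uncountable one. *)
Lemma tau_additive_bigcup_le (I : Type) (G : set I) (U : I -> set X) M :
  (forall i, G i -> open (U i)) ->
  (forall D : set I, finite_set D -> D `<=` G ->
    mu (\bigcup_(i in D) U i) <= M) ->
  mu (\bigcup_(i in G) U i) <= M.
Proof.
move=> oU UM; pose V i := [set y | G i /\ U i y].
have -> : \bigcup_(i in G) U i = \bigcup_i V i.
  by apply/seteqP; split => y [i]; [move=> Gi Uy|move=> _ [Gi Uy]]; exists i.
rewrite (mms_tau_additive hmu); last first.
  move=> i; have [Gi|nGi] := pselect (G i).
    rewrite (_ : V i = U i); first exact: oU.
    by apply/seteqP; split => y; rewrite /V /=; tauto.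
  rewrite (_ : V i = set0); first exact: open0.
  by apply/seteqP; split => y; rewrite /V /=; tauto.
apply: ge_ereal_sup => _ [D fD <-].
rewrite (_ : \bigcup_(i in D) V i = \bigcup_(i in D `&` G) U i).
  by apply: UM; [exact: finite_setIl|exact: subIsetr].
apply/seteqP; split => y [i].
  by move=> Di [Gi Uy]; exists i.
by move=> [Di Gi] Uy; exists i.
Qed.

Lemma open_setC_support : open (~` measure_support mu).
Proof. by rewrite setCK; apply: bigcup_open => b _; exact: open_mball. Qed.

(** A finite union of null balls is null, and the complement of the support is
    a union of null balls, possibly uncountable: in a non-separable space
    only tau-additivity gives this. *)
Lemma setC_support_null : mu (~` measure_support mu) = 0.
Proof.
apply/eqP; rewrite eq_le measure_ge0 andbT setCK.
apply: (@tau_additive_bigcup_le _ _ (fun b : X * R => ball b.1 b.2)) => [b _|D].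
  exact: open_mball.
move=> fD DG; have [s Ds] := (finite_seqP D).1 fD; rewrite Ds bigcup_seq.
have mB (b : X * R) : measurable (ball b.1 b.2).
  exact/measurable_open/open_mball.
elim: s D Ds DG {fD} => [|b s IH] D Ds DG; first by rewrite big_nil measure0.
have mU : measurable (\big[setU/set0]_(i <- s) ball i.1 i.2).
  by apply: bigsetU_measurable => i _; exact: mB.
rewrite big_cons; apply: le_trans (measureU2 _ (mB b) mU) _.
have [|_ /= b0] := DG b; first by rewrite Ds /= mem_head.
rewrite [X in X + _]b0 add0e; apply: (IH [set` s]) => // i /= si.
by apply: DG; rewrite Ds /= in_cons si orbT.
Qed.

(** * Superlevel sets of the maximal function *)

(** The condition is cleared of division, so that both sides are monotone in
    the ball. *)
Lemma centered_maximal_gtP (g : X -> R) (a : R) x :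
  a%:E < centered_maximal mu g x <->
  exists r, [/\ (0 < r)%R, 0 < mu (cball x r) &
    a%:E * mu (cball x r) < \int[mu]_(y in cball x r) `|(g y)%:E|].
Proof.
have avgE r : 0 < mu (cball x r) ->
    (a%:E < (mu (cball x r))^-1 * \int[mu]_(y in cball x r) `|(g y)%:E|) =
    (a%:E * mu (cball x r) < \int[mu]_(y in cball x r) `|(g y)%:E|).
  have := cball_fin_num x r; case: (mu (cball x r)) => // b _.
  rewrite lte_fin => b0; rewrite inver gt_eqF//= lte_pdivlMl// muleC.
  by [].
split.
  move=> /ereal_sup_gtP[_ [r [r0 B0] <-]]; rewrite avgE// => h.
  by exists r.
move=> [r [r0 B0 h]]; apply/ereal_sup_gtP.
by eexists; [exists r => //|rewrite avgE].
Qed.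

(** Let the average of [|g|] over [cball x r] exceed [a]. By right-continuity
    there is [e] such that [a mu(cball x (r + e))] is still below the integral
    over [cball x r]. If [y] is [e/2]-close to [x], then [cball y (r + e/2)]
    lies between [cball x r] and [cball x (r + e)], so its average exceeds [a]
    too. *)
Lemma open_centered_maximal_gt (g : X -> R) (a : R) :
  measurable_fun setT g -> (0 < a)%R ->
  open [set x | a%:E < centered_maximal mu g x].
Proof.
move=> mg a0; rewrite openE => x /= /centered_maximal_gtP[r [r0 B0 h]].
have [e e0 he] : exists2 e, (0 < e)%R &
    a%:E * mu (cball x (r + e)) < \int[mu]_(y in cball x r) `|(g y)%:E|.
  have [|e e0 he] := @measure_cball_right_continuous x r
    ((a^-1)%:E * \int[mu]_(y in cball x r) `|(g y)%:E|).
    by rewrite lte_pdivlMl.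
  by exists e => //; rewrite -lte_pdivlMl.
apply/nbhs_ballP; exists (e / 2)%R => /=; first by rewrite divr_gt0.
move=> y; rewrite ballEmdist /= => xy; apply/centered_maximal_gtP.
have sub1 : cball x r `<=` cball y (r + e / 2).
  by apply: cball_sub_cball; rewrite metric_sym addrC lerD2l ltW.
have sub2 : cball y (r + e / 2) `<=` cball x (r + e).
  by apply: cball_sub_cball; rewrite addrCA lerD2l [leRHS]splitr lerD2r ltW.
exists (r + e / 2)%R; split; first by rewrite addr_gt0// divr_gt0.
  by apply: lt_le_trans B0 _; apply: le_measure => //; rewrite inE;
    exact: measurable_cball.
apply: (@le_lt_trans _ _ (a%:E * mu (cball x (r + e)))).
  apply: lee_wpmul2l; first by rewrite lee_fin ltW.
  by apply: le_measure => //; rewrite inE; exact: measurable_cball.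
apply: lt_le_trans he _.
by apply: subset_integral_abs => //; exact: measurable_cball.
Qed.

End metric_measure.

(** * The Boman inequality for disjoint sets, and its dual use *)

Section weak_boman.
Context (R : realType) (d : measure_display) (X : measurableMetricType R d).
Variable mu : {measure set X -> \bar R}.
Hypothesis hmu : metric_measure_space mu.
Local Open Scope ereal_scope.

(** With the weights [mu (E i)], the function on the right-hand side of the
    Boman inequality is the indicator of the union of the disjoint sets [E i].
    Indexing by [nat], and allowing the [E i] to be null, fits the sets obtained
    from a cover by successive differences. *)
Lemma weak_boman_trivIset (q C : R) : (0 < q)%R -> weak_boman mu q%:E C ->
  exists T : R -> R, (forall r, 0 < r -> 0 < T r)%R /\
  forall (n : nat) (x : nat -> X) (r : nat -> R) (E : nat -> set X),
    (forall i, (i < n)%N -> measure_support mu (x i)) ->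
    (forall i, (i < n)%N -> 0 < r i)%R ->
    (forall i, measurable (E i)) -> trivIset setT E ->
    (forall i, (i < n)%N -> E i `<=` cball (x i) (T (r i) * r i)%R) ->
    'N[mu]_q%:E[EFin \o (fun y => \sum_(i < n)
      fine (mu (E i)) / fine (mu (cball (x i) (r i))) *
        \1_(cball (x i) (r i)) y)%R]
    <= C%:E * mu (\big[setU/set0]_(i < n) E i) `^ q^-1.
Proof.
move=> q0 [C0 [T [T01 boman]]]; exists T; split.
  by move=> r /T01/andP[].
move=> n x r E sx r0 mE tE Esub.
have finE i : (i < n)%N -> mu (E i) \is a fin_num.
  move=> i_n; rewrite ge0_fin_numE//.
  apply: le_lt_trans (cball_ltoo hmu (x i) (T (r i) * r i)).
  apply: le_measure; last exact: Esub; rewrite inE; first exact: mE.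
  exact: (measurable_cball hmu).
(* The Boman hypothesis requires sets of positive measure: the null [E i] have
   weight zero, so leaving their indices out does not change the left-hand
   side and can only shrink the union on the right. *)
pose s := [seq i <- index_iota 0 n | 0 < mu (E i)].
have s_n i : i \in s -> (i < n)%N.
  by rewrite mem_filter mem_index_iota => /andP[].
have sE i : i \in s -> 0 < mu (E i) by rewrite mem_filter => /andP[].
have us : uniq s by rewrite filter_uniq// iota_uniq.
pose k := tnth (in_tuple s).
have ks j : k j \in s by exact: mem_tnth.
have wE i : i \in s -> mu (E i) = (fine (mu (E i)))%:E.
  by move=> si; rewrite fineK// finE// s_n.
have w0 i : i \in s -> (0 < fine (mu (E i)))%R.
  by move=> si; rewrite -lte_fin -wE// sE.
pose h i y := (fine (mu (E i)) / fine (mu (cball (x i) (r i))) *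
  \1_(cball (x i) (r i)) y)%R.
have hE y : (\sum_(i < n) h i y = \sum_(i <- s) h i y)%R.
  rewrite big_filter -(big_mkord xpredT (h ^~ y)) [RHS]big_mkcond/=.
  apply: eq_big_nat => i /andP[_ i_n]; case: ifPn => //.
  rewrite -leNgt => Ei0.
  have Ei0' : mu (E i) = 0 by apply/eqP; rewrite eq_le Ei0 measure_ge0.
  by rewrite /h Ei0' /= !mul0r.
have mU : measurable (\bigcup_(i in [set` s]) E i).
  by rewrite bigcup_seq; exact: bigsetU_measurable.
have sU : \bigcup_(i in [set` s]) E i `<=` \big[setU/set0]_(i < n) E i.
  move=> y [i /= /s_n i_n Ey]; rewrite -bigcup_mkord.
  by exists i.
have t0 j : (0 < T (r (k j)) <= T (r (k j)))%R.
  by rewrite lexx andbT; have /andP[] := T01 _ (r0 _ (s_n _ (ks j))).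
have := boman (size s) (x \o k) (r \o k) (fun j => fine (mu (E (k j))))
  (fun j => T (r (k j))) (E \o k) (fun j => sx _ (s_n _ (ks j)))
  (fun j => r0 _ (s_n _ (ks j))) (fun j => w0 _ (ks j)) t0
  (fun j => mE _) (fun j => sE _ (ks j)) (fun j => Esub _ (s_n _ (ks j))).
set L := 'N[mu]_ _ [_]; set L' := 'N[mu]_ _ [_] => LC.
have -> : 'N[mu]_q%:E[EFin \o (fun y => \sum_(i < n) h i y)%R] = L.
  apply: eq_Lnorm => y /=; rewrite hE -sumEFin [LHS]big_tnth.
  apply: eq_bigr => j _; rewrite /h /= -/(k j).
  have := cball_gt0 hmu (r0 _ (s_n _ (ks j))) (sx _ (s_n _ (ks j))).
  have := cball_fin_num hmu (x (k j)) (r (k j)).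
  case: (mu (cball (x (k j)) (r (k j)))) => //= b _; rewrite lte_fin => b0.
  by rewrite inver gt_eqF//= mulrAC.
apply: le_trans LC _; apply: lee_wpmul2l; first by rewrite lee_fin ltW.
have -> : L' = mu (\bigcup_(i in [set` s]) E i) `^ q^-1.
  rewrite -Lnorm_indic//; apply: eq_Lnorm => y /=.
  rewrite -(sum_indic_trivIset _ _ us tE) -sumEFin [RHS]big_tnth.
  apply: eq_bigr => j _; rewrite -/(k j) {2}wE// inver gt_eqF ?w0//=.
  by rewrite -EFinM mulrAC divff ?mul1r// gt_eqF ?w0.
apply: gt0_ler_poweR; rewrite ?in_itv /= ?measure_ge0 ?leey//.
  by rewrite invr_ge0 ltW.
apply: le_measure => //; rewrite inE//; exact: bigsetU_measurable.
Qed.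

(** The hypothesis on the averages bounds [a mu(E i)] by the integral of [|g|]
    against [mu(E i) 1_B / mu(B)], where [B] is the [i]-th ball. Summing over
    [i] and applying Hoelder's inequality gives the result. *)
Lemma weak_boman_duality (p q a : R) (g : X -> R) (n : nat)
    (x : nat -> X) (r : nat -> R) (E : nat -> set X) :
  (0 < p)%R -> (0 < q)%R -> (p^-1 + q^-1 = 1)%R ->
  measurable_fun setT g ->
  (forall i, (i < n)%N -> measure_support mu (x i)) ->
  (forall i, (i < n)%N -> 0 < r i)%R ->
  (forall i, measurable (E i)) -> trivIset setT E ->
  (forall i, mu (E i) < +oo) ->
  (forall i, (i < n)%N -> a%:E * mu (cball (x i) (r i)) <=
    \int[mu]_(y in cball (x i) (r i)) `|(g y)%:E|) ->
  a%:E * mu (\big[setU/set0]_(i < n) E i) <=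
  'N[mu]_p%:E[EFin \o g] *
  'N[mu]_q%:E[EFin \o (fun y => \sum_(i < n)
      fine (mu (E i)) / fine (mu (cball (x i) (r i))) *
        \1_(cball (x i) (r i)) y)%R].
Proof.
move=> p0 q0 pq mg sx r0 mE tE finE avg.
pose c i := (fine (mu (E i)) / fine (mu (cball (x i) (r i))))%R.
have c0 i : (0 <= c i)%R by rewrite divr_ge0// fine_ge0.
have mB i : measurable (cball (x i) (r i)) by exact: (measurable_cball hmu).
have mk : measurable_fun setT (fun y => \sum_(i < n) c i *
    \1_(cball (x i) (r i)) y)%R.
  by apply: measurable_sum => i; apply: measurable_funM.
apply: le_trans (hoelder mu mg mk p0 q0 pq); rewrite Lnorm1.
have -> : mu (\big[setU/set0]_(i < n) E i) = \sum_(i < n) mu (E i).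
  exact: measure_bigsetU.
rewrite ge0_sume_distrr//.
apply: (@le_trans _ _ (\sum_(i < n)
    \int[mu]_y (`|g y| * (c i * \1_(cball (x i) (r i)) y))%:E)).
  apply: lee_sum => i _; rewrite -integral_abs_indic//.
  have := avg i (ltn_ord i).
  have := cball_gt0 hmu (r0 i (ltn_ord i)) (sx i (ltn_ord i)).
  have bf := cball_fin_num hmu (x i) (r i); rewrite -(fineK bf) lte_fin => b0.
  rewrite -(@fineK _ (mu (E i))) ?ge0_fin_numE//.
  move=> /(lee_wpmul2l (_ : 0 <= (c i)%:E)); rewrite lee_fin => /(_ (c0 i)).
  apply: le_trans; rewrite -!EFinM lee_fin /c.
  by rewrite mulrCA divfK ?gt_eqF.
rewrite -ge0_integral_sum//; last 2 first.
- move=> i; apply/measurable_EFinP; apply: measurable_funM.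
    exact: measurableT_comp.
  by apply: measurable_funM => //; exact: measurable_indic.
- by move=> i y _; rewrite lee_fin !mulr_ge0// indicE.
rewrite le_eqVlt; apply/orP; left; apply/eqP; apply: eq_integral => y _.
rewrite /= sumEFin -mulr_sumr.
by rewrite normrM (ger0_norm (sumr_ge0 _ _))// => i _; rewrite mulr_ge0// indicE.
Qed.

End weak_boman.

(** * The weak type inequality *)

Section weak_boman_weak_type.
Context (R : realType) (d : measure_display) (X : measurableMetricType R d).
Variable mu : {measure set X -> \bar R}.
Hypothesis hmu : metric_measure_space mu.
Local Open Scope ereal_scope.

(** The finite estimate applied to every finite subfamily of the cover of the
    superlevel set by contracted balls centered in the support. *)
Lemma weak_boman_weak_type_bound (p q C : R) :
  (0 < p)%R -> (0 < q)%R -> (p^-1 + q^-1 = 1)%R -> weak_boman mu q%:E C ->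
  weak_type_bound mu p (centered_maximal mu) C.
Proof.
move=> p0 q0 pq hC g gL a a0.
have mg : measurable_fun setT g by have := sub_Lfun_mfun gL; rewrite inE.
have C0 : (0 < C)%R by case: hC.
have [N N0 gN] : exists2 N, (0 <= N)%R & 'N[mu]_p%:E[EFin \o g] = N%:E.
  have := sub_Lfun_finLfun gL; rewrite inE /= /finite_norm => gfin.
  exists (fine 'N[mu]_p%:E[EFin \o g]); first exact/fine_ge0/Lnorm_ge0.
  by rewrite fineK// ge0_fin_numE// Lnorm_ge0.
have [T [T0 boman]] := weak_boman_trivIset hmu q0 hC.
set A := [set x | _]; have oA : open A by exact: open_centered_maximal_gt.
have mA := measurable_open hmu oA; split=> //.
have -> : (C%:E * 'N[mu]_p%:E[EFin \o g] / a%:E) `^ p =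
    ((N * C / a) `^ p)%:E.
  by rewrite gN inver gt_eqF//= [(N * C)%R]mulrC.
(* A radius is chosen at each point before the cover is formed, because the
   contraction factor depends on it. *)
have /choice[r rP] : forall x, exists r, A x ->
    (0 < r)%R /\ a%:E * mu (cball x r) <= \int[mu]_(y in cball x r) `|(g y)%:E|.
  move=> x; have [|nAx] := pselect (A x); last by exists 0%R.
  by move=> /(centered_maximal_gtP hmu)[r [r0 _ /ltW h]]; exists r.
pose B x := ball x (T (r x) * r x)%R.
have oB x : open (B x) by exact: open_mball.
have mB x : measurable (B x) by exact: (measurable_open hmu).
set S := measure_support mu.
have oU : open (\bigcup_(x in A `&` S) B x) by apply: bigcup_open.
have mU := measurable_open hmu oU.
have mS := measurable_open hmu (open_setC_support mu).
apply: (@le_trans _ _ (mu (\bigcup_(x in A `&` S) B x `|` ~` S))).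
  apply: le_measure; rewrite ?inE//; first exact: measurableU.
  move=> x Ax; have [Sx|] := pselect (S x); last by right.
  left; exists x => //; apply: ballxx.
  by have [r0 _] := rP _ Ax; rewrite mulr_gt0// T0.
rewrite -[leRHS]adde0; apply: le_trans (measureU2 _ mU mS) _.
have S0 := setC_support_null hmu; rewrite -[in leRHS]S0 leeD2r//.
apply: (tau_additive_bigcup_le hmu) => // D fD DG.
have [[|x0 s] Ds] := (finite_seqP D).1 fD.
  by rewrite Ds bigcup_seq big_nil measure0 lee_fin powR_ge0.
pose n := size (x0 :: s); pose x i := nth x0 (x0 :: s) i.
have xG i : (i < n)%N -> (A `&` S) (x i).
  by move=> i_n; apply: DG; rewrite Ds /=; exact: mem_nth.
pose E := seqDU (B \o x).
have mE i : measurable (E i) by apply: seqDU_measurable => j; exact: mB.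
have tE : trivIset setT E by exact: trivIset_seqDU.
have EB i : E i `<=` cball (x i) (T (r (x i)) * r (x i)).
  by apply: (subset_trans (@subset_seqDU _ (B \o x) i)); exact: ball_sub_cball.
have Efin i : mu (E i) < +oo.
  apply: le_lt_trans (cball_ltoo hmu (x i) (T (r (x i)) * r (x i))).
  by apply: le_measure (EB i); rewrite inE//; exact: (measurable_cball hmu).
have -> : \bigcup_(y in D) B y = \big[setU/set0]_(i < n) E i.
  by rewrite Ds bigcup_seq (big_nth x0) big_mkord -bigsetU_seqDU.
set m := mu _; have mfin : m \is a fin_num.
  rewrite /m (_ : mu _ = \sum_(i < n) mu (E i)); last exact: measure_bigsetU.
  by apply/sum_fin_numP => i _ _; rewrite ge0_fin_numE.
have r0 i : (i < n)%N -> (0 < r (x i))%R by move=> /xG[/rP[]].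
have avg i : (i < n)%N -> a%:E * mu (cball (x i) (r (x i))) <=
    \int[mu]_(y in cball (x i) (r (x i))) `|(g y)%:E| by move=> /xG[/rP[]].
have Sx i : (i < n)%N -> S (x i) by move=> /xG[].
have := weak_boman_duality hmu p0 q0 pq mg Sx r0 mE tE Efin avg.
have := boman n x (r \o x) E Sx r0 mE tE (fun i _ => EB i).
rewrite -/m gN => /(lee_wpmul2l (_ : 0 <= N%:E)); rewrite lee_fin => /(_ N0).
move=> le1 /le_trans /(_ le1) {le1}.
rewrite -(fineK mfin) poweR_EFin -!EFinM !lee_fin mulrA.
apply: powR_absorb => //; first exact/fine_ge0/measure_ge0.
by rewrite mulr_ge0// ltW.
Qed.

End weak_boman_weak_type.

Theorem theorem4p5 (R : realType) (d : measure_display)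
  (X : measurableMetricType R d) (mu : {measure set X -> \bar R})
  (p q C : R) (hp : 1 < p) (hq : q = p / (p - 1))
  (hmu : metric_measure_space mu) (hC : weak_boman mu q%:E C) :
  weak_type mu p (centered_maximal mu) /\
  (weak_type_norm mu p (centered_maximal mu) <= C%:E)%E.
Proof.
have p0 : 0 < p by exact: lt_trans hp.
have p1 : 0 < p - 1 by rewrite subr_gt0.
have q0 : 0 < q by rewrite hq divr_gt0.
have pq : p^-1 + q^-1 = 1.
  by rewrite hq invf_div -[X in X + _]div1r -mulrDl addrC subrK divff ?gt_eqF.
have bound := weak_boman_weak_type_bound hmu p0 q0 pq hC.
have C0 : 0 < C by case: hC.
split; first by exists C.
by apply: ereal_inf_lbound; exists C.
Qed.
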